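(* Let $H$ be a complex Hilbert space of finite dimension $D\ge 2$ and let $\mathcal A,\mathcal B,\mathcal C$ be $\dagger$-special commutative Frobenius algebras on $H$ such that $(\mathcal A,\mathcal B)$ and $(\mathcal A,\mathcal C)$ are strongly complementary pairs. Then $\mathcal B$ and $\mathcal C$ are not strongly complementary.
   Context: A commutative Frobenius algebra on $H$ consists of linear maps $\mu:H\otimes H\to H$, $\eta:\mathbb C\to H$, $\delta:H\to H\otimes H$, $\epsilon:H\to\mathbb C$ such that $(\mu,\eta)$ is a commutative monoid, $(\delta,\epsilon)$ is a cocommutative comonoid and $(1\otimes\mu)(\delta\otimes1)=\delta\mu=(\mu\otimes1)(1\otimes\delta)$. It is $\dagger$-special ($\dagger$-SCFA) if $\mu=\delta^\dagger$, $\eta=\epsilon^\dagger$ and $\mu\delta=1_H$. Two $\dagger$-SCFAs $\mathcal O=(\mu_O,\eta_O,\delta_O,\epsilon_O)$, $\mathcal O'=(\mu_{O'},\eta_{O'},\delta_{O'},\epsilon_{O'})$ on the $D$-dimensional space $H$ are strongly complementary if $(\mu_O,\eta_O,\delta_{O'},\epsilon_{O'})$ is a bialgebra up to scalar factors (scaled bialgebra equations), i.e. with $\sigma$ the swap on $H\otimes H$: $$\delta_{O'}\mu_O=\sqrt D\,(\mu_O\otimes\mu_O)(1\otimes\sigma\otimes1)(\delta_{O'}\otimes\delta_{O'}),\quad \sqrt D\,\delta_{O'}\eta_O=\eta_O\otimes\eta_O,\quad \sqrt D\,\epsilon_{O'}\mu_O=\epsilon_{O'}\otimes\epsilon_{O'}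 .$$ (Taking adjoints, this condition is symmetric in $\mathcal O$ and $\mathcal O'$.) *)

(* Defs.v *)
From HB Require Import structures.
From mathcomp Require Import all_boot all_order all_algebra.

Set Implicit Arguments.
Unset Strict Implicit.
Unset Printing Implicit Defensive.

Import Order.TTheory GRing.Theory Num.Theory Num.Def.

Local Open Scope ring_scope.

Section TensorProduct.
Variable K : fieldType.
Implicit Types U V W X Y : vectType K.

Definition tbasis U (i : 'I_(\dim {:U})) : U := (vbasis {:U})`_i.

Definition tcoord U (u : U) (i : 'I_(\dim {:U})) : K :=
  coord (vbasis {:U}) i u.

(* A tensor is represented by its coordinates with respect to the basis
   [tbasis i ⊗ tbasis j].  Nothing below depends on the choice of bases: all
   maps are built with [tlift], which is characterized by [tliftE]. *)
Definition tensor U V : vectType K := 'M[K]_(\dim {:U}, \dim {:V}).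

Definition tens U V (u : U) (v : V) : tensor U V :=
  \matrix_(i, j) (tcoord u i * tcoord v j).

Definition tlift_fun U V W (b : U -> V -> W) (t : tensor U V) : W :=
  \sum_i \sum_j t i j *: b (tbasis i) (tbasis j).

(* The linear map on [U ⊗ V] induced by [b : U × V -> W], meaningful when [b]
   is bilinear. *)
Definition tlift U V W (b : U -> V -> W) : 'Hom(tensor U V, W) :=
  linfun (tlift_fun b).

Definition tmap U V W X (f : 'Hom(U, W)) (g : 'Hom(V, X)) :
    'Hom(tensor U V, tensor W X) :=
  tlift (fun u v => tens (f u) (g v)).

Definition tswap U V : 'Hom(tensor U V, tensor V U) :=
  tlift (fun u v => tens v u).

Definition tassoc U V W :
    'Hom(tensor (tensor U V) W, tensor U (tensor V W)) :=
  tlift (fun t w => tlift (fun u v => tens u (tens v w)) t).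

Definition tassocV U V W :
    'Hom(tensor U (tensor V W), tensor (tensor U V) W) :=
  tlift (fun u t => tlift (fun v w => tens (tens u v) w) t).

Definition tunitl U : 'Hom(tensor K^o U, U) := tlift (fun (c : K^o) u => (c : K) *: u).

Definition tunitr U : 'Hom(tensor U K^o, U) := tlift (fun u (c : K^o) => (c : K) *: u).

(* The map [1 ⊗ σ ⊗ 1], bracketed as a map
   (U ⊗ V) ⊗ (W ⊗ X) -> (U ⊗ W) ⊗ (V ⊗ X). *)
Definition tswap_mid U V W X :
    'Hom(tensor (tensor U V) (tensor W X), tensor (tensor U W) (tensor V X)) :=
  tlift (fun s t =>
    tlift (fun u v =>
      tlift (fun w x => tens (tens u w) (tens v x)) t) s).

Lemma tens_linearl U V (v : V) : linear (fun u : U => tens u v).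
Proof.
move=> a u u'; apply/matrixP => i j.
by rewrite !mxE /tcoord linearP mulrDl mulrA.
Qed.

Lemma tens_linearr U V (u : U) : linear (fun v : V => tens u v).
Proof.
move=> a v v'; apply/matrixP => i j.
by rewrite !mxE /tcoord linearP mulrDr mulrCA.
Qed.

Lemma tlift_fun_linear U V W (b : U -> V -> W) : linear (tlift_fun b).
Proof.
move=> a s t; rewrite /tlift_fun scaler_sumr -big_split; apply: eq_bigr => i _.
rewrite /= scaler_sumr -big_split; apply: eq_bigr => j _ /=.
by rewrite !mxE scalerDl scalerA.
Qed.

HB.instance Definition _ U V W (b : U -> V -> W) :=
  GRing.isLinear.Build K (tensor U V) W *:%R (tlift_fun b)
    (tlift_fun_linear b).

Lemma tbasisE U (u : U) : u = \sum_i tcoord u i *: tbasis i.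
Proof. exact/coord_vbasis/memvf. Qed.

Lemma tens_coord U V (u : U) (v : V) i j :
  (tens u v : 'M_(_, _)) i j = tcoord u i * tcoord v j.
Proof. by rewrite /tens mxE. Qed.

Lemma tcoord_basis U (i j : 'I_(\dim {:U})) :
  tcoord (tbasis i) j = (j == i)%:R.
Proof.
by rewrite /tcoord coord_free 1?eq_sym // (basis_free (vbasisP _)).
Qed.

Lemma tliftE U V W (b : U -> V -> W) :
    (forall v, linear (b^~ v)) -> (forall u, linear (b u)) ->
  forall u v, tlift b (tens u v) = b u v.
Proof.
move=> bl br u v; rewrite lfunE /= /tlift_fun.
pose blL v' := GRing.isLinear.Build K U W *:%R (b^~ v') (bl v').
pose bl' v' : {linear U -> W} := HB.pack (b^~ v') (blL v').
pose brL u' := GRing.isLinear.Build K V W *:%R (b u') (br u').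
pose br' u' : {linear V -> W} := HB.pack (b u') (brL u').
rewrite [RHS](_ : _ = bl' v u) // {2}(tbasisE u) linear_sum.
apply: eq_bigr => i _; rewrite linearZ /=.
rewrite [b _ v](_ : _ = br' (tbasis i) v) // {2}(tbasisE v) linear_sum.
rewrite scaler_sumr; apply: eq_bigr => j _.
by rewrite linearZ scalerA tens_coord.
Qed.

(* A linear map on [U ⊗ V] is determined by its values on pure tensors. *)
Lemma tensor_ext U V W (f g : 'Hom(tensor U V, W)) :
  (forall u v, f (tens u v) = g (tens u v)) -> f = g.
Proof.
move=> fg; apply/lfunP => t.
have -> : t = \sum_i \sum_j t i j *: tens (tbasis i) (tbasis j).
  rewrite [LHS]matrix_sum_delta; apply: eq_bigr => i _; apply: eq_bigr => j _.
  congr (_ *: _); apply/matrixP => k l.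
  by rewrite tens_coord !tcoord_basis !mxE -natrM mulnb.
rewrite !linear_sum; apply: eq_bigr => i _.
by rewrite !linear_sum; apply: eq_bigr => j _; rewrite !linearZ /= fg.
Qed.

Lemma tmapE U V W X (f : 'Hom(U, W)) (g : 'Hom(V, X)) u v :
  tmap f g (tens u v) = tens (f u) (g v).
Proof.
rewrite tliftE // => [v' a x y|u' a x y]; rewrite linearP /=.
  exact: tens_linearl.
exact: tens_linearr.
Qed.

Lemma tswapE U V (u : U) (v : V) : tswap U V (tens u v) = tens v u.
Proof.
by rewrite tliftE // => [v'|u']; [apply: tens_linearr | apply: tens_linearl].
Qed.

Lemma tlift_lin U V W Y (c : Y -> U -> V -> W) t :
    (forall u v, linear (fun y => c y u v)) ->
  linear (fun y => tlift (c y) t).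
Proof.
move=> cl a y z; rewrite !lfunE /= /tlift_fun scaler_sumr -big_split /=.
apply: eq_bigr => i _; rewrite scaler_sumr -big_split /=; apply: eq_bigr => j _.
by rewrite cl scalerDr !scalerA mulrC.
Qed.

Lemma tassocE U V W (u : U) (v : V) (w : W) :
  tassoc U V W (tens (tens u v) w) = tens u (tens v w).
Proof.
rewrite tliftE => [|w' a x y|t]; last 2 first.
- by rewrite linearP.
- by apply: tlift_lin => u' v' a x y; rewrite !tens_linearr.
rewrite tliftE // => [v'|u' a x y]; first exact: tens_linearl.
by rewrite tens_linearl tens_linearr.
Qed.

Lemma tassocVE U V W (u : U) (v : V) (w : W) :
  tassocV U V W (tens u (tens v w)) = tens (tens u v) w.
Proof.
rewrite tliftE => [|t|u' a x y]; last 2 first.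
- by apply: tlift_lin => v' w' a x y; rewrite !tens_linearl.
- by rewrite linearP.
rewrite tliftE // => [w' a x y|v']; last exact: tens_linearr.
by rewrite tens_linearr tens_linearl.
Qed.

Lemma tunitlE U (c : K^o) (u : U) : tunitl U (tens c u) = (c : K) *: u.
Proof.
rewrite tliftE // => [v a x y|x a y z]; first by rewrite scalerDl scalerA.
by rewrite scalerDr !scalerA mulrC.
Qed.

Lemma tunitrE U (c : K^o) (u : U) : tunitr U (tens u c) = (c : K) *: u.
Proof.
rewrite tliftE // => [x a y z|v a x y]; last by rewrite scalerDl scalerA.
by rewrite scalerDr !scalerA mulrC.
Qed.

Lemma tswap_midE U V W X (u : U) (v : V) (w : W) (x : X) :
  tswap_mid U V W X (tens (tens u v) (tens w x)) =
  tens (tens u w) (tens v x).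
Proof.
rewrite tliftE => [|t a y z|s]; last 2 first.
- by rewrite linearP.
- by apply: tlift_lin => u' v' a y z; rewrite linearP.
rewrite tliftE => [|v'|u']; last 2 first.
- by apply: tlift_lin => w' x' a y z; rewrite !tens_linearl.
- by apply: tlift_lin => w' x' a y z; rewrite tens_linearl tens_linearr.
rewrite tliftE // => [x' a y z|w']; last first.
  by move=> a y z; rewrite !tens_linearr.
by rewrite tens_linearr tens_linearl.
Qed.

End TensorProduct.

Section InnerProduct.
Variable C : numClosedFieldType.
Implicit Types U V : vectType C.

(* Inner products are linear in their first argument and conjugate-linear in
   the second one, as in the library's [{dot U for conjC}]. *)
Definition scalar_dot (a b : C^o) : C := a * (b : C)^*.

(* The inner product of [U ⊗ V], i.e. the sesquilinear extension of
   <u ⊗ v, u' ⊗ v'> = <u, u'> <v, v'>; see [tensor_dotE]. *)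
Definition tensor_dot U V (dotU : U -> U -> C) (dotV : V -> V -> C)
    (s t : tensor U V) : C :=
  \sum_i \sum_j \sum_k \sum_l s i j * (t k l)^* *
    (dotU (tbasis i) (tbasis k) * dotV (tbasis j) (tbasis l)).

(* [f = g^†]: the adjoint of [g] is the unique [f] with this property. *)
Definition is_adjoint U V (dotU : U -> U -> C) (dotV : V -> V -> C)
    (f : 'Hom(U, V)) (g : 'Hom(V, U)) : Prop :=
  forall u v, dotV (f u) v = dotU u (g v).

Lemma dot_basis U (dotU : {dot U for conjC}) u v :
  dotU u v = \sum_i \sum_k tcoord u i * (tcoord v k)^* *
    dotU (tbasis i) (tbasis k).
Proof.
rewrite {1}(tbasisE u) linear_sumlz; apply: eq_bigr => i _.
rewrite linearZl_LR /= {1}(tbasisE v) linear_sumr /= mulr_sumr.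
by apply: eq_bigr => k _; rewrite linearZr_LR /= mulrA.
Qed.

Lemma tensor_dotE U V (dotU : {dot U for conjC}) (dotV : {dot V for conjC})
    u v u' v' :
  tensor_dot dotU dotV (tens u v) (tens u' v') = dotU u u' * dotV v v'.
Proof.
rewrite (dot_basis dotU u) (dot_basis dotV v) /tensor_dot mulr_suml.
apply: eq_bigr => i _.
rewrite mulr_sumr; apply: eq_bigr => j _.
rewrite mulr_suml; apply: eq_bigr => k _.
rewrite mulr_sumr; apply: eq_bigr => l _.
by rewrite !tens_coord rmorphM /= (mulrACA (tcoord u i)) [RHS]mulrACA.
Qed.

End InnerProduct.

Section Frobenius.
Variables (C : numClosedFieldType) (H : vectType C).

Record frobenius_data := FrobeniusData {
  fmul : 'Hom(tensor H H, H);
  funit : 'Hom(C^o, H);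
  fcomul : 'Hom(H, tensor H H);
  fcounit : 'Hom(H, C^o) }.

Local Open Scope lfun_scope.

Record is_commutative_monoid (mu : 'Hom(tensor H H, H)) (eta : 'Hom(C^o, H)) :
    Prop := IsCommutativeMonoid {
  monoid_assoc : mu \o tmap mu \1 = mu \o tmap \1 mu \o tassoc H H H;
  monoid_unitl : mu \o tmap eta \1 = tunitl H;
  monoid_unitr : mu \o tmap \1 eta = tunitr H;
  monoid_comm : mu \o tswap H H = mu }.

Record is_cocommutative_comonoid
    (delta : 'Hom(H, tensor H H)) (epsilon : 'Hom(H, C^o)) :
    Prop := IsCocommutativeComonoid {
  comonoid_coassoc :
    tassoc H H H \o tmap delta \1 \o delta = tmap \1 delta \o delta;
  comonoid_counitl : tunitl H \o tmap epsilon \1 \o delta = \1;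
  comonoid_counitr : tunitr H \o tmap \1 epsilon \o delta = \1;
  comonoid_cocomm : tswap H H \o delta = delta }.

Record is_commutative_frobenius (O : frobenius_data) : Prop :=
  IsCommutativeFrobenius {
  frobenius_monoid : is_commutative_monoid (fmul O) (funit O);
  frobenius_comonoid : is_cocommutative_comonoid (fcomul O) (fcounit O);
  frobenius_lawl :
    tmap \1 (fmul O) \o tassoc H H H \o tmap (fcomul O) \1
    = fcomul O \o fmul O;
  frobenius_lawr :
    fcomul O \o fmul O
    = tmap (fmul O) \1 \o tassocV H H H \o tmap \1 (fcomul O) }.

Record is_dagger_SCFA (dotH : {dot H for conjC}) (O : frobenius_data) : Prop :=
  IsDaggerSCFA {
  dagger_frobenius : is_commutative_frobenius O;
  dagger_mul :
    is_adjoint (tensor_dot dotH dotH) dotH (fmul O) (fcomul O);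
  dagger_unit : is_adjoint (@scalar_dot C) dotH (funit O) (fcounit O);
  dagger_special : fmul O \o fcomul O = \1 }.

(* [tunitl C^o] is the identification of C ⊗ C with C. *)
Record strongly_complementary (O O' : frobenius_data) : Prop :=
  StronglyComplementary {
  sc_mul_comul :
    fcomul O' \o fmul O
    = sqrtC (\dim {:H})%:R *:
      (tmap (fmul O) (fmul O) \o tswap_mid H H H H
       \o tmap (fcomul O') (fcomul O'));
  sc_unit_comul :
    sqrtC (\dim {:H})%:R *: (fcomul O' \o funit O \o tunitl C^o)
    = tmap (funit O) (funit O);
  sc_mul_counit :
    sqrtC (\dim {:H})%:R *: (fcounit O' \o fmul O)
    = tunitl C^o \o tmap (fcounit O') (fcounit O') }.

End Frobenius.

(* Main.v *)
(* The unit x of A is, up to the factor sqrt D, copied by the comultiplications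
   of both B and C: B and C share a classical point.  Hence
   mu_B (x, x) = sqrt D x (B is special) and epsilon_C x = sqrt D (counit law of
   C), so that evaluating sqrt D epsilon_C mu_B = epsilon_C ⊗ epsilon_C at x ⊗ x
   gives D sqrt D = D, which is absurd for D > 1. *)

Require Import Defs.
From mathcomp Require Import all_boot all_order all_algebra.
From mathcomp Require Import reals complex.

Import GRing.Theory Num.Theory.

Local Open Scope ring_scope.

Section StrongComplementarity.
Context {K : numClosedFieldType} {H : vectType K}.
Implicit Types (O : frobenius_data H) (x y : H).

Definition unit_vector O : H := funit O (1 : K^o).

Lemma mul_unit_vector O x :
  is_commutative_monoid (fmul O) (funit O) ->
  fmul O (tens (unit_vector O) x) = x.
Proof.
case=> _ /lfunP/(_ (tens (1 : K^o) x)) + _ _.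
by rewrite comp_lfunE tmapE id_lfunE tunitlE scale1r.
Qed.

(** If the unit were 0, the unit law would give y = mu (0 ⊗ y) = 0 for every y, so [H] would be the
    zero space. *)
Lemma unit_vector_neq0 O :
  is_commutative_monoid (fmul O) (funit O) -> (0 < \dim {:H})%N ->
  unit_vector O != 0.
Proof.
move=> monO; rewrite lt0n dimv_eq0; apply: contraNneq => x0.
apply/eqP/vspaceP => y; rewrite memvf memv0 -(mul_unit_vector O y monO) x0.
have -> : tens (0 : H) y = 0.
  by apply/matrixP => i j; rewrite !mxE /tcoord linear0 mul0r.
by rewrite linear0 eqxx.
Qed.

(** Evaluating the unit equation at 1 ⊗ 1 yields the scaled copyable vector needed by the two lemmas
    on copyable vectors below. *)
Lemma strongly_complementary_comul_unit O O' :
  strongly_complementary O O' ->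
  sqrtC (\dim {:H})%:R *: fcomul O' (unit_vector O) =
  tens (unit_vector O) (unit_vector O).
Proof.
case=> _ /lfunP/(_ (tens (1 : K^o) (1 : K^o))) + _.
by rewrite scale_lfunE !comp_lfunE tmapE tunitlE scale1r.
Qed.

Lemma strongly_complementary_counit_mul O O' x y :
  strongly_complementary O O' ->
  sqrtC (\dim {:H})%:R * fcounit O' (fmul O (tens x y)) =
  fcounit O' x * fcounit O' y.
Proof.
case=> _ _ /lfunP/(_ (tens x y)).
by rewrite scale_lfunE !comp_lfunE tmapE tunitlE.
Qed.

(** Apply mu to both sides of the copy equation; specialness cancels mu delta. *)
Lemma mul_scaled_copyable O (s : K) x :
  (fmul O \o fcomul O = \1)%VF -> s *: fcomul O x = tens x x ->
  fmul O (tens x x) = s *: x.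
Proof.
move=> /lfunP/(_ x); rewrite comp_lfunE id_lfunE => spec <-.
by rewrite linearZ /= spec.
Qed.

(** Applying epsilon ⊗ 1 to the copy equation gives s x = epsilon(x) x by the counit law, and a
    nonzero x can be cancelled. *)
Lemma counit_scaled_copyable O (s : K) x :
  is_cocommutative_comonoid (fcomul O) (fcounit O) ->
  s *: fcomul O x = tens x x -> x != 0 -> fcounit O x = s.
Proof.
case=> _ /lfunP/(_ x); rewrite !comp_lfunE id_lfunE => counit _ _ copy x0.
have /(congr1 (tunitl H \o tmap (fcounit O) \1)%VF) := copy.
rewrite linearZ /= !comp_lfunE counit tmapE id_lfunE tunitlE.
move=> /eqP; rewrite -subr_eq0 -scalerBl scaler_eq0 (negPf x0) orbF.
by rewrite subr_eq0 => /eqP.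
Qed.

End StrongComplementarity.

Theorem theorem7p2p10 (R : realType) (H : vectType (complex R))
    (dotH : {dot H for Num.conj}) (hdim : (2 <= \dim {:H})%N)
    (A B C : frobenius_data H)
    (hA : is_dagger_SCFA dotH A) (hB : is_dagger_SCFA dotH B)
    (hC : is_dagger_SCFA dotH C)
    (hAB : strongly_complementary A B) (hAC : strongly_complementary A C) :
  ~ strongly_complementary B C.
Proof.
move=> hBC; set s : complex R := sqrtC (\dim {:H})%:R.
have monA := frobenius_monoid (dagger_frobenius hA).
have comonC := frobenius_comonoid (dagger_frobenius hC).
have x0 := unit_vector_neq0 _ monA (ltnW hdim).
have mulB := mul_scaled_copyable _ _ _ (dagger_special hB)
  (strongly_complementary_comul_unit _ _ hAB).
have counitC := counit_scaled_copyable _ _ _ comonC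
  (strongly_complementary_comul_unit _ _ hAC) x0.
have := strongly_complementary_counit_mul _ _ (unit_vector A) (unit_vector A) hBC.
(* Here [s3] says s^3 = s^2: one factor s on the left comes from [hBC], one from [mulB] and one from
   [counitC]. *)
rewrite mulB linearZ /= counitC -/s => s3.
have s0 : s != 0 by rewrite sqrtC_eq0 pnatr_eq0 -lt0n ltnW.
have s1 : s = 1 by apply: (mulfI s0); apply: (mulfI s0); rewrite mulr1.
have /eqP : s ^+ 2 = 1 by rewrite s1 expr1n.
(* Since s^2 = D, characteristic zero turns this into D = 1 in the naturals. *)
by rewrite sqrtCK -[1]/(1%:R) eqr_nat => /eqP dim1; rewrite dim1 in hdim.
Qed.
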